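(* Let $\tau\subseteq\{\sqcup,\mathbin{@},-,\underline{\phantom{a}}[\underline{\phantom{a}}]\}$. For any nonempty sets $X,Y$, the algebra ${\bf S}=\langle\mathcal{P}(X,Y),\tau\rangle$ is isomorphic to a subalgebra of a direct power of ${\bf 3}_\tau$. Consequently $\operatorname{Rep}(\tau)$ coincides exactly with the class $\mathsf{SP}({\bf 3}_\tau)$ of algebras isomorphic to subalgebras of direct powers of ${\bf 3}_\tau$.
   Context: For nonempty sets $X,Y$, $\mathcal{P}(X,Y)$ denotes the set of all partial functions from $X$ to $Y$. Operations on partial functions: override $(f\sqcup g)(x)=f(x)$ if $x\in\mathrm{dom}(f)$, $=g(x)$ if $x\in\mathrm{dom}(g)\setminus\mathrm{dom}(f)$, undefined otherwise; update $f[g]$ is the restriction of $g\sqcup f$ to $\mathrm{dom}(f)$; restrictive multiplication $f\mathbin{@}g$ is the restriction of $f$ to $\mathrm{dom}(g)$; minus $f-g$ is the restriction of $g$ to the complement of $\mathrm{dom}(f)$. For a set $\tau$ of these operations, a $\tau$-algebra of functions is a subset of some $\mathcal{P}(X,Y)$ closed under the operations in $\tau$, and $\operatorname{Rep}(\tau)$ is the class of algebras (in signature $\tau$) isomorphic to $\tau$-algebras of functions. ${\bf 3}$ denotes the algebra $\mathcal{P}(\{x\},\{+,-\})$ with all four operations, whose elements are written $0$ (the empty function), $1$ ($x\mapsto +$), $2$ ($x\mapsto -$); ${\bf 3}_\tau$ is its reduct to the operations in $\tau$. *)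

(* Defs.v *)
From mathcomp Require Import all_boot boolp classical_sets.

Set Implicit Arguments.
Unset Strict Implicit.
Unset Printing Implicit Defensive.

Local Open Scope classical_set_scope.

(** Partial functions. *)

Definition pfun (X Y : Type) := X -> option Y.

Section PartialFunctions.
Variables X Y : Type.
Implicit Types (f g : pfun X Y) (D : set X).

Definition dom f : set X := [set x | isSome (f x)].

Definition pfrestrict f D : pfun X Y := fun x => if x \in D then f x else None.

Definition override f g : pfun X Y :=
  fun x => if f x is Some y then Some y else g x.

(* [update f g] is f[g]. *)
Definition update f g : pfun X Y := pfrestrict (override g f) (dom f).

Definition rmult f g : pfun X Y := pfrestrict f (dom g).

(* It is the second argument that gets restricted: f - g is g outside dom f. *)
Definition pfminus f g : pfun X Y := pfrestrict g (~` dom f).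

End PartialFunctions.

(** Algebras in a signature tau of binary operation symbols. *)

Inductive opsym := Override | RMult | Minus | Update.

(* The carrier may be empty.  A set [tau] coerces to the type of its elements,
   so [interp] is defined only on the symbols that belong to [tau]. *)
Record algebra (tau : set opsym) := Algebra {
  carrier :> Type;
  interp : tau -> carrier -> carrier -> carrier
}.

Section Algebras.
Variable tau : set opsym.
Implicit Types A B : algebra tau.

Definition homomorphism A B (h : A -> B) :=
  forall (o : tau) (a b : A), h (interp o a b) = interp o (h a) (h b).

Definition isomorphic A B := exists h : A -> B, homomorphism h /\ bijective h.

Definition closed_under_ops A (S : set A) :=
  forall (o : tau) (a b : A), S a -> S b -> S (interp o a b).

Definition subalgebra A (S : set A) (clS : closed_under_ops S) : algebra tau :=
  @Algebra tau S (fun o a b =>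
    exist _ (interp o (val a) (val b))
      (mem_set (clS o _ _ (set_mem (valP a)) (set_mem (valP b))))).

(* The index type [I] may be empty, in which case the power is trivial. *)
Definition power (I : Type) A : algebra tau :=
  @Algebra tau (I -> A) (fun o a b i => interp o (a i) (b i)).

(* Isomorphic to a subalgebra of a direct power of [B]. *)
Definition SP B A :=
  exists (I : Type) (S : set (power I B)) (clS : closed_under_ops S),
    isomorphic A (subalgebra clS).

Definition pfun_op X Y (o : opsym) : pfun X Y -> pfun X Y -> pfun X Y :=
  match o with
  | Override => @override X Y
  | RMult => @rmult X Y
  | Minus => @pfminus X Y
  | Update => @update X Y
  end.

Definition pfun_algebra (X Y : Type) : algebra tau :=
  @Algebra tau (pfun X Y) (fun o => pfun_op (val o)).

(* [subalgebra clS] is here an arbitrary tau-algebra of functions. *)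
Definition Rep A :=
  exists (X Y : Type) (S : set (pfun_algebra X Y)) (clS : closed_under_ops S),
    [/\ inhabited X, inhabited Y & isomorphic A (subalgebra clS)].

End Algebras.

(* The values + and -. *)
Inductive sign := Plus | Neg.

(* The one-point domain {x} is [unit]. *)
Definition three (tau : set opsym) : algebra tau := pfun_algebra tau unit sign.

(* Main.v *)
(** The operations are computed pointwise by operations on [option Y], so
    composing with a map [Y -> Y'] of values is a homomorphism. Hence each
    pair (x, y) gives a homomorphism P(X,Y) -> 3 evaluating at x and recording
    whether the value is y (sent to +) or not (sent to -), and these jointly
    separate partial functions. Conversely 3^I is the set of partial functions
    from I to the signs; a spare point where every function is undefined is
    added to I so that the domain is nonempty even for the empty power. *)

Require Import Defs.
From mathcomp Require Import all_boot boolp classical_sets.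

Set Implicit Arguments.
Unset Strict Implicit.
Unset Printing Implicit Defensive.

Local Open Scope classical_set_scope.

(** The range of an injective homomorphism is closed under the operations. Embeddings, unlike
    subalgebras, compose directly. *)
Lemma embedding_subalgebra (tau : set opsym) (A B : algebra tau) :
  (exists (S : set B) (clS : closed_under_ops S),
     isomorphic A (subalgebra clS)) <->
  exists h : A -> B, homomorphism h /\ injective h.
Proof.
split=> [[S [clS [h [homh bijh]]]]|[h [homh injh]]].
  exists (fun a => val (h a)); split=> [o a b|]; first by rewrite homh.
  exact: (inj_comp val_inj (bij_inj bijh)).
have cl : closed_under_ops (range h).
  by move=> o _ _ [a _ <-] [b _ <-]; exists (interp o a b).
exists (range h), cl.
have ranP a : h a \in range h by apply: mem_set; exists a.
pose k a : subalgebra cl := exist _ (h a) (ranP a).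
(* [bijective] asks for an inverse function, so preimages are picked by choice. *)
have preim (s : subalgebra cl) : {a | h a = val s}.
  by apply: cid; have [a _ ha] := set_mem (valP s); exists a.
exists k; split=> [o a b|]; first by apply: val_inj; exact: homh.
exists (fun s => sval (preim s)) => [a|s].
  exact: injh (svalP (preim (k a))).
by apply: val_inj; exact: (svalP (preim s)).
Qed.

Lemma SP_embedding (tau : set opsym) (A B : algebra tau) :
  SP B A <->
  exists (I : Type) (h : A -> power I B), homomorphism h /\ injective h.
Proof. by split=> -[I /embedding_subalgebra ?]; exists I. Qed.

Lemma Rep_embedding (tau : set opsym) (A : algebra tau) :
  Rep A <->
  exists X Y : Type, [/\ inhabited X, inhabited Y &
    exists h : A -> pfun_algebra tau X Y, homomorphism h /\ injective h].
Proof.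
split=> [[X [Y [S [clS [iX iY iso]]]]]|[X [Y [iX iY /embedding_subalgebra]]]].
  by exists X, Y; split=> //; apply/embedding_subalgebra; exists S, clS.
by case=> S [clS iso]; exists X, Y, S, clS.
Qed.

Definition option_op Y (o : opsym) (a b : option Y) : option Y :=
  match o with
  | Override => if a is Some _ then a else b
  | RMult => if b is Some _ then a else None
  | Minus => if a is Some _ then None else b
  | Update => if a is Some _ then if b is Some _ then b else a else None
  end.

Lemma pfun_opE X Y o (f g : pfun X Y) x :
  pfun_op o f g x = option_op o (f x) (g x).
Proof.
have in_dom (u : pfun X Y) : (x \in dom u) = isSome (u x).
  by apply/idP/idP => [/set_mem|/mem_set].
case: o; rewrite /= /override /rmult /pfminus /update /pfrestrict /override
  ?in_setC ?in_dom; by case: (f x); case: (g x).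
Qed.

(** Each operation looks only at which arguments are defined, then returns one of them or [None];
    hence [v] need not be injective. *)
Lemma option_op_omap Y Z (v : Y -> Z) o a b :
  omap v (option_op o a b) = option_op o (omap v a) (omap v b).
Proof. by case: o a b => [] [?|] [?|]. Qed.

(** This keeps the spare point undefined under every operation. *)
Lemma option_op_None Y o : option_op o None None = None :> option Y.
Proof. by case: o. Qed.

Definition sign_eq Y (y z : Y) : sign := if `[< z = y >] then Plus else Neg.

(** [omap] preserves definedness, and testing against the value of [a] itself yields [Plus], which
    forces [b] to share that value. *)
Lemma omap_sign_eq_inj Y (a b : option Y) :
  (forall y, omap (sign_eq y) a = omap (sign_eq y) b) -> a = b.
Proof.
(* The test value is taken from a defined side, since [Y] may be empty. *)
case: a b => [a|] [b|] // ab; [|by have := ab a|by have := ab b].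
have := ab a; rewrite /= /sign_eq asboolT //.
by case: asboolP => // ->.
Qed.

Lemma pfun_algebra_embedding (tau : set opsym) (X Y : Type) :
  exists (I : Type) (h : pfun_algebra tau X Y -> power I (three tau)),
    homomorphism h /\ injective h.
Proof.
exists (X * Y)%type, (fun f p _ => omap (sign_eq p.2) (f p.1)); split.
  move=> o f g; apply/funext => p; apply/funext => t /=.
  by rewrite !pfun_opE option_op_omap.
move=> f g fg; apply/funext => x; apply: omap_sign_eq_inj => y.
exact: (congr1 (fun h : X * Y -> pfun unit sign => h (x, y) tt) fg).
Qed.

Lemma power_three_embedding (tau : set opsym) (I : Type) :
  exists h : power I (three tau) -> pfun_algebra tau (option I) sign,
    homomorphism h /\ injective h.
Proof.
exists (fun f => oapp (fun i => f i tt) None); split.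
  move=> o f g; apply/funext => -[i|] /=; rewrite !pfun_opE //=.
  by rewrite option_op_None.
move=> f g fg; apply/funext => i; apply/funext => -[].
exact: (congr1 (fun h : pfun (option I) sign => h (Some i)) fg).
Qed.

Lemma homomorphism_comp (tau : set opsym) (A B C : algebra tau)
    (k : B -> C) (h : A -> B) :
  homomorphism k -> homomorphism h -> homomorphism (k \o h).
Proof. by move=> homk homh o a b /=; rewrite homh homk. Qed.

Theorem theorem3p3 (tau : set opsym) :
  (forall X Y : Type, inhabited X -> inhabited Y ->
     SP (three tau) (pfun_algebra tau X Y)) /\
  (forall A : algebra tau, Rep A <-> SP (three tau) A).
Proof.
split=> [X Y _ _|A]; first exact/SP_embedding/pfun_algebra_embedding.
split=> [/Rep_embedding[X [Y [_ _ [h [homh injh]]]]]|].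
  have [I [k [homk injk]]] := pfun_algebra_embedding tau X Y.
  apply/SP_embedding; exists I, (k \o h).
  by split; [exact: homomorphism_comp|exact: inj_comp].
move=> /SP_embedding[I [h [homh injh]]].
have [k [homk injk]] := power_three_embedding tau I.
apply/Rep_embedding; exists (option I), sign; split.
- exact: inhabits None.
- exact: inhabits Plus.
- by exists (k \o h); split; [exact: homomorphism_comp|exact: inj_comp].
Qed.
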